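(* Every signed triangular grid $G$ satisfies $\chi_s(G)\le 10$.
   Context: A signed graph $G=(V,E,s)$ is a finite simple graph (no loops, no parallel edges) with a signature $s:E\to\{-1,+1\}$ (positive and negative edges). Switching a vertex $v$ reverses the sign of every edge incident to $v$. A homomorphism of signed graphs $G\to H$ is a map $\varphi:V(G)\to V(H)$ such that, after switching some subset of the vertices of $G$, every edge $uv$ of $G$ is mapped to an edge $\varphi(u)\varphi(v)$ of $H$ with the same sign. The chromatic number $\chi_s(G)$ of a signed graph $G$ is the minimum order of a signed graph $H$ such that $G$ admits a homomorphism to $H$. A triangular grid is a finite induced subgraph of the (infinite) graph of the tiling of the plane by equilateral triangles; a signed triangular grid is a triangular grid with an arbitrary signature. *)

(* Defs.v *)
From mathcomp Require Import all_boot all_order all_algebra.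
From mathcomp Require Import boolp.
From mathcomp Require Import zify.

Set Implicit Arguments.
Unset Strict Implicit.
Unset Printing Implicit Defensive.

(* [neg u v] says that the edge uv is negative; its values on non-adjacent
   pairs carry no meaning and are never used. *)
Record signed_graph (V : finType) := SignedGraph {
  edge : rel V;
  edge_sym : symmetric edge;
  edge_irr : irreflexive edge;
  neg : rel V;
  neg_sym : symmetric neg
}.

Definition switch_vertex (V : finType) (v : V) (s : rel V) : rel V :=
  fun x y => if (x == v) || (y == v) then ~~ s x y else s x y.

Definition switch (V : finType) (S : {set V}) (s : rel V) : rel V :=
  foldr (@switch_vertex V) s (enum S).

Definition signed_hom (V W : finType) (G : signed_graph V)
    (H : signed_graph W) (phi : V -> W) : Prop :=
  exists S : {set V}, forall u v : V, edge G u v ->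
    edge H (phi u) (phi v) /\
    neg H (phi u) (phi v) = switch S (neg G) u v.

Definition hom_to_order (V : finType) (G : signed_graph V) (n : nat) : Prop :=
  exists (W : finType) (H : signed_graph W),
    #|W| = n /\ exists phi : V -> W, signed_hom G H phi.

Lemma ex_hom_to_order (V : finType) (G : signed_graph V) :
  exists n, `[< hom_to_order G n >].
Proof.
exists #|V|; apply/asboolP; exists V, G; split=> //; exists id, set0 => u v uv.
by split=> //; rewrite /switch enum_set0.
Qed.

Definition chi_s (V : finType) (G : signed_graph V) : nat :=
  ex_minn (ex_hom_to_order G).

(* (a, b) stands for the point a e1 + b e2 of the triangular lattice, where e1
   and e2 are unit vectors at an angle of 60 degrees; the six neighbours of a
   point are its translates by e1, e2, e1 - e2 and their opposites. *)
Definition tri_adj : rel (int * int) := fun p q =>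
  ((q.1 - p.1, q.2 - p.2) \in
    [:: (1, 0); (-1, 0); (0, 1); (0, -1); (1, -1); (-1, 1)])%R.

(* The squared Euclidean norm of a e1 + b e2 is a^2 + a b + b^2, so adjacent
   points are exactly those at distance 1. *)
Lemma tri_adj_dist (p q : int * int) :
  tri_adj p q =
  (((q.1 - p.1) ^+ 2 + (q.1 - p.1) * (q.2 - p.2) + (q.2 - p.2) ^+ 2 == 1)%R).
Proof.
rewrite /tri_adj !inE !xpair_eqE.
move: (q.1 - p.1)%R (q.2 - p.2)%R => a b {p q}.
apply/idP/eqP => [|h].
  by do 5?[case/orP]; case/andP=> /eqP-> /eqP->.
have ha : (-1 <= a <= 1)%R by nia.
have hb : (-1 <= b <= 1)%R by nia.
have [ea|[ea|ea]] : a = (-1)%R \/ a = 0%R \/ a = 1%R by lia.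
all: have [eb|[eb|eb]] : b = (-1)%R \/ b = 0%R \/ b = 1%R by lia.
all: by move: h; rewrite ea eb.
Qed.

Definition triangular_grid (V : finType) (G : signed_graph V) : Prop :=
  exists f : V -> int * int,
    injective f /\ forall u v : V, edge G u v = tri_adj (f u) (f v).

(* Main.v *)
Require Import Defs.
From mathcomp Require Import all_boot.
From mathcomp Require Import all_algebra boolp zify.

(** The target is the complete graph on the Paley graph of order 9 (a 3 x 3
    board, where squares in the same row or column are joined positively and the
    other pairs negatively) together with a tenth vertex joined positively to
    everything.  Recording for every vertex also whether it is switched gives 20
    colours.  The grid is coloured row by row; a vertex of the new row has two
    neighbours in the previous row and one to its left.  Two colours [d != d']
    attached to [c] by the same sign always admit, for every other constraint,
    two colours of the next vertex of the row reachable from [d] or [d'].  Hence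
    along the new row at least two colours remain reachable at each vertex, and
    a colouring of the row is read off backwards. *)

Set Implicit Arguments.
Unset Strict Implicit.
Unset Printing Implicit Defensive.

(** * The target graph *)

Definition paley_neg (x y : nat) : bool :=
  [&& x < 9, y < 9, x %/ 3 != y %/ 3 & x %% 3 != y %% 3].

Lemma paley_neg_sym : symmetric paley_neg.
Proof.
move=> x y; rewrite /paley_neg [x %/ 3 == _]eq_sym [x %% 3 == _]eq_sym.
by rewrite andbCA.
Qed.

Definition paley9_plus : signed_graph 'I_10.
Proof.
refine (@SignedGraph _ (fun x y : 'I_10 => x != y) _ _
          (fun x y : 'I_10 => paley_neg x y) _).
- by move=> x y; rewrite eq_sym.
- by move=> x; rewrite eqxx.
- by move=> x y; apply: paley_neg_sym.
Defined.

(* A colour is a vertex of the target (a number below 10) and a bit telling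
   whether the coloured vertex is switched. *)
Definition color : Type := (nat * bool)%type.

Definition compatible (s : bool) (u v : color) : bool :=
  (u.1 != v.1) && (paley_neg u.1 v.1 (+) u.2 (+) v.2 == s).

Lemma compatible_sym s : symmetric (compatible s).
Proof.
by move=> u v; rewrite /compatible eq_sym paley_neg_sym addbAC.
Qed.

(** The switch of a neighbour is absorbed into the sign of the edge, so the exhaustive checks below
    may take the colours of the previous row unswitched. *)
Lemma compatible_unswitch s u x b :
  compatible s u (x, b) = compatible (s (+) b) u (x, false).
Proof.
rewrite /compatible /= addbF; congr (_ && _).
by case: b s (paley_neg _ _ (+) _) => [] [] [].
Qed.

Definition bools : seq bool := [:: false; true].

Definition colors : seq color := [seq (x, b) | x <- iota 0 10, b <- bools].

Lemma mem_bools b : b \in bools. Proof. by case: b. Qed.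

Lemma mem_colors (u : color) : (u \in colors) = (u.1 < 10).
Proof.
apply/allpairsP/idP => [[p [hp _ ->]]|hu]; first by rewrite mem_iota in hp.
by exists u; rewrite mem_iota mem_bools -surjective_pairing.
Qed.

(** * Finite checks on the target *)

Definition common (s t : bool) (x y : nat) : seq color :=
  [seq e <- colors | compatible s e (x, false) & compatible t e (y, false)].

Lemma two_common :
  all (fun x => all (fun y => (x == y) || all (fun s => all (fun t =>
    1 < size (common s t x y)) bools) bools) (iota 0 10)) (iota 0 10).
Proof. by vm_compute. Qed.

(** Here [x] belongs to the vertex of the previous row adjacent both to the last coloured vertex,
    with candidates [d] and [d'], and to the next one; this is why [d] and [d'] share the sign [s].
    The other neighbour of the next vertex in the previous row has colour [y], and [h] is the sign
    of the edge inside the new row. *)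
Lemma two_reachable :
  all (fun x => all (fun s =>
    let N := [seq d <- colors | compatible s d (x, false)] in
    all (fun y => (x == y) || all (fun t => all (fun u =>
      let C := common t u x y in
      all (fun h => all (fun d => all (fun d' => (d == d') ||
        (1 < size [seq e <- C | compatible h d e || compatible h d' e])) N) N)
    bools) bools) bools) (iota 0 10)) bools) (iota 0 10).
Proof. by vm_compute. Qed.

Lemma uniq_size_gt1 (T : eqType) (s : seq T) :
  uniq s -> 1 < size s -> exists x y, [/\ x != y, x \in s & y \in s].
Proof.
case: s => [|x [|y s]] //= /andP[]; rewrite inE negb_or => /andP[xy _] _ _.
by exists x, y; rewrite !inE !eqxx orbT.
Qed.

Lemma uniq_common s t x y : uniq (common s t x y).
Proof. exact: filter_uniq. Qed.

Lemma mem_common e s t (c c' : color) :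
  (e \in common (s (+) c.2) (t (+) c'.2) c.1 c'.1) =
  [&& e.1 < 10, compatible s e c & compatible t e c'].
Proof.
case: c c' => x b [y b'].
by rewrite mem_filter mem_colors andbC -!compatible_unswitch.
Qed.

Lemma exists_common (c c' : color) s t :
  c.1 < 10 -> c'.1 < 10 -> c.1 != c'.1 ->
  exists e e' : color, [/\ e != e',
    [&& e.1 < 10, compatible s e c & compatible t e c'] &
    [&& e'.1 < 10, compatible s e' c & compatible t e' c']].
Proof.
move=> hc hc' /negbTE ne; have /allP/(_ c.1) := two_common.
rewrite mem_iota => /(_ hc) /allP/(_ c'.1).
rewrite mem_iota ne => /(_ hc') /allP/(_ _ (mem_bools (s (+) c.2))).
move/allP/(_ _ (mem_bools (t (+) c'.2)))/(uniq_size_gt1 (uniq_common _ _ _ _)).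
by case=> e [e' []]; rewrite !mem_common => *; exists e, e'.
Qed.

Lemma exists_reachable (c c' d d' : color) s t u h :
  c.1 < 10 -> c'.1 < 10 -> c.1 != c'.1 ->
  d.1 < 10 -> d'.1 < 10 -> d != d' -> compatible s d c -> compatible s d' c ->
  let next (e : color) := compatible h d e || compatible h d' e in
  exists e e' : color, [/\ e != e',
    [&& e.1 < 10, compatible t e c & compatible u e c'] && next e &
    [&& e'.1 < 10, compatible t e' c & compatible u e' c'] && next e'].
Proof.
move=> hc hc' /negbTE ne hd hd' /negbTE nd sd sd' next.
have /allP/(_ c.1) := two_reachable.
rewrite mem_iota => /(_ hc) /allP/(_ _ (mem_bools (s (+) c.2))) /allP/(_ c'.1).
rewrite mem_iota ne => /(_ hc') /allP/(_ _ (mem_bools (t (+) c.2))).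
move/allP/(_ _ (mem_bools (u (+) c'.2)))/allP/(_ _ (mem_bools h)).
move/allP/(_ d); rewrite mem_filter mem_colors hd -compatible_unswitch.
rewrite -surjective_pairing sd => /(_ isT) /allP/(_ d').
rewrite mem_filter mem_colors hd' -compatible_unswitch -surjective_pairing.
rewrite sd' nd => /(_ isT).
case/(uniq_size_gt1 (filter_uniq _ (uniq_common _ _ _ _))) => e [e' []].
by rewrite !(mem_filter next) !mem_common ![next _ && _]andbC; exists e, e'.
Qed.

(** * Colouring row by row *)

(* The vertices [i] and [i.+1] of the previous row are the neighbours of the
   vertex [i] of the new one, by edges of signs [sl i] and [sr i]. *)
Definition above (c : nat -> color) (sl sr : nat -> bool) i (e : color) :=
  [&& e.1 < 10, compatible (sl i) e (c i) & compatible (sr i) e (c i.+1)].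

Definition new_row c sl sr (h : nat -> bool) n (d : nat -> color) :=
  (forall i, i <= n -> above c sl sr i (d i)) /\
  (forall i, i < n -> compatible (h i) (d i) (d i.+1)).

Lemma new_row_rcons c sl sr h n d e :
  new_row c sl sr h n d -> above c sl sr n.+1 e -> compatible (h n) (d n) e ->
  new_row c sl sr h n.+1 [eta d with n.+1 |-> e].
Proof.
move=> [d1 d2] he hd; split=> i hi /=.
  case: eqP => [->//|/eqP ne]; apply: d1.
  by rewrite -ltnS ltn_neqAle ne.
rewrite (ltn_eqF hi) eqSS; case: eqP => [->//|/eqP ne].
by apply: d2; rewrite ltn_neqAle ne.
Qed.

Lemma exists_new_row c sl sr h n :
  (forall i, i <= n.+1 -> (c i).1 < 10) ->
  (forall i, i <= n -> (c i).1 != (c i.+1).1) ->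
  exists d, new_row c sl sr h n d.
Proof.
move=> hc nc.
(* One colouring would not survive the induction; two that differ at the last vertex do. *)
suff [d [d' []]] : exists d d', [/\ d n != d' n, new_row c sl sr h n d &
    new_row c sl sr h n d'] by exists d.
elim: n hc nc => [|n IHn] hc nc.
  have [e [e' [ne he he']]] := exists_common (sl 0) (sr 0) (hc 0 isT)
    (hc 1 isT) (nc 0 isT).
  by exists (fun=> e), (fun=> e'); split=> //; split=> // i; case: i.
have [//||d [d' [nd hd hd']]] := IHn.
- by move=> i hi; apply: hc; apply: leqW.
- by move=> i hi; apply: nc; apply: leqW.
(* Both last colours are attached by the sign [sr n] to [c n.+1], which is also a neighbour of the
   vertex to be added. *)
have /and3P[d10 _ dc] := hd.1 _ (leqnn n).
have /and3P[d10' _ dc'] := hd'.1 _ (leqnn n).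
have extend e : above c sl sr n.+1 e ->
    compatible (h n) (d n) e || compatible (h n) (d' n) e ->
    exists2 f, f n.+1 = e & new_row c sl sr h n.+1 f.
  move=> he /orP[] hn.
    by exists [eta d with n.+1 |-> e]; [rewrite /= eqxx|apply: new_row_rcons].
  by exists [eta d' with n.+1 |-> e]; [rewrite /= eqxx|apply: new_row_rcons].
have [e [e' [ne /andP[a1 b1] /andP[a2 b2]]]] :=
  exists_reachable (sl n.+1) (sr n.+1) (h n) (hc _ (leqnSn _)) (hc _ (leqnn _))
    (nc _ (leqnn _)) d10 d10' nd dc dc'.
have [f fe hf] := extend e a1 b1.
have [f' fe' hf'] := extend e' a2 b2.
by exists f, f'; rewrite fe fe'.
Qed.

(* The point [(i, j)] of the lattice is the vertex [i] of row [j]. *)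
Lemma exists_grid_coloring (s : rel (nat * nat)) k n :
  exists F : nat -> nat -> color, forall i j, j <= k -> i + j <= n + k ->
    [/\ (F i j).1 < 10,
        i + j < n + k -> compatible (s (i, j) (i.+1, j)) (F i j) (F i.+1 j),
        0 < j -> compatible (s (i, j) (i, j.-1)) (F i j) (F i j.-1) &
        0 < j ->
        compatible (s (i, j) (i.+1, j.-1)) (F i j) (F i.+1 j.-1)].
Proof.
elim: k n => [|k IHk] n.
  (* Row 0 is placed on a fictitious row whose colours alternate between 0 and 1, so that
     consecutive ones differ. *)
  have [||d [d1 d2]] := @exists_new_row (fun i => (odd i : nat, false))
    xpred0 xpred0 (fun i => s (i, 0) (i.+1, 0)) n.
  - by move=> i _ /=; case: odd.
  - by move=> i _ /=; case: odd.
  exists (fun i _ => d i) => i j; rewrite leqn0 => /eqP ->.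
  by rewrite !addn0 => hi; have /and3P[? _ _] := d1 i hi; split=> //; apply: d2.
have [F hF] := IHk n.+1.
have [||d [d1 d2]] := @exists_new_row (F^~ k)
    (fun i => s (i, k.+1) (i, k)) (fun i => s (i, k.+1) (i.+1, k))
    (fun i => s (i, k.+1) (i.+1, k.+1)) n.
- by move=> i hi; have [|] := hF i k (leqnn _); first by rewrite leq_add2r.
- move=> i hi; have [|_ + _ _] := hF i k (leqnn _).
    by rewrite leq_add2r leqW.
  by rewrite ltn_add2r ltnS => /(_ hi) /andP[].
exists (fun i j => if j == k.+1 then d i else F i j) => i j.
rewrite leq_eqVlt => /orP[/eqP -> {j}|].
  rewrite leq_add2r ltn_add2r eqxx /= (ltn_eqF (ltnSn k)) => hi.
  by have /and3P[] := d1 i hi; split=> // ; apply: d2.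
rewrite ltnS addnS -addSn => hj hi.
have jk1 : j == k.+1 = false by apply/negbTE; rewrite neq_ltn ltnS hj.
have jk2 : j.-1 == k.+1 = false.
  by apply/negbTE; rewrite neq_ltn ltnS (leq_trans (leq_pred _) hj).
by rewrite jk1 jk2; apply: hF.
Qed.

(** * From colourings to homomorphisms *)

Lemma switchE (V : finType) (S : {set V}) (s : rel V) (u v : V) :
  u != v -> switch S s u v = s u v (+) (u \in S) (+) (v \in S).
Proof.
move=> uv; rewrite /switch -!(mem_enum S).
elim: (enum S) (enum_uniq S) => [|w l IHl] /=; first by rewrite !addbF.
case/andP=> wl /IHl {}IHl; rewrite /switch_vertex IHl !inE.
have [uw|nuw] := eqVneq u w; have [vw|nvw] := eqVneq v w => //=.
(* A loop at [w] would be flipped once, whereas its two membership bits cancel. *)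
- by rewrite uw vw eqxx in uv.
- by rewrite uw (negbTE wl) addbF addbT addNb.
- by rewrite vw (negbTE wl) addbF addbT.
Qed.

Lemma hom_of_coloring (V : finType) (G : signed_graph V) (C : V -> color) :
  (forall u, (C u).1 < 10) ->
  (forall u v, edge G u v -> compatible (neg G u v) (C u) (C v)) ->
  hom_to_order G 10.
Proof.
move=> hC hE; exists 'I_10, paley9_plus; split; first exact: card_ord.
exists (fun u => Ordinal (hC u)), [set u | (C u).2] => u v uv.
have /andP[ne /eqP sE] := hE u v uv; split=> //=.
rewrite switchE; last by apply: contraTneq uv => ->; rewrite edge_irr.
by rewrite !inE -sE addbAC !addbK.
Qed.

Theorem theorem3 (V : finType) (G : signed_graph V)
  (hG : triangular_grid G) : (chi_s G <= 10)%N.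
Proof.
rewrite /chi_s; case: ex_minnP => m _; apply; apply/asboolP.
have [f [f_inj fE]] := hG.
pose A := \max_(v : V) (`|(f v).1| + `|(f v).2|)%N.
have fA v : (`|(f v).1| + `|(f v).2| <= A)%N.
  exact: (@leq_bigmax _ (fun v => `|(f v).1| + `|(f v).2|)%N).
(* The shift by [A] brings all coordinates between 0 and [2 * A], inside the trapezoid with both
   parameters [2 * A]. *)
pose g v := (`|((f v).1 + A%:Z)%R|%N, `|((f v).2 + A%:Z)%R|%N).
have g_inj : injective g.
  move=> u v [e1 e2]; apply: f_inj; have := (fA u, fA v).
  case: (f u) (f v) e1 e2 => [a b] [a' b'] /= e1 e2 [? ?].
  by congr pair; lia.
pose back p := [pick v | g v == p].
have backK v : back (g v) = Some v.
  rewrite /back; case: pickP => [w /eqP/g_inj -> //|/(_ v)].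
  by rewrite eqxx.
(* The default sign off the image of [g] is harmless: only pairs [g a], [g b] are compared with
   [G]. *)
pose s p q := if (back p, back q) is (Some u, Some v) then neg G u v else false.
have [F hF] := exists_grid_coloring s (2 * A) (2 * A).
have hg v : (g v).2 <= 2 * A /\ (g v).1 + (g v).2 <= 2 * A + 2 * A.
  by have := fA v; rewrite /=; split; lia.
have sg a b : s (g a) (g b) = neg G a b by rewrite /s !backK.
(* Half of the six directions, namely those controlled by [exists_grid_coloring]; the other half
   follows by symmetry. The guards exclude the truncated predecessor of 0. *)
pose later (p q : nat * nat) := [|| q == (p.1.+1, p.2),
  (0 < p.2) && (q == (p.1, p.2.-1)) | (0 < p.2) && (q == (p.1.+1, p.2.-1))].
have hE a b : later (g a) (g b) ->
    compatible (neg G a b) (F (g a).1 (g a).2) (F (g b).1 (g b).2).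
  rewrite -sg; move: (hg a) (hg b).
  case: (g a) (g b) => [i j] [i' j'] [/= ha1 ha2] [/= hb1 hb2].
  have [_ H1 H2 H3] := hF i j ha1 ha2; rewrite /later /= !xpair_eqE.
  case/or3P=> [/andP|/andP[j0 /andP]|/andP[j0 /andP]] [/eqP ei /eqP ej].
  - by subst i' j'; apply: H1; lia.
  - by subst i' j'; apply: H2.
  - by subst i' j'; apply: H3.
apply: (@hom_of_coloring V G (fun v => F (g v).1 (g v).2)) => [u|u v].
  by have [hu1 hu2] := hg u; have [] := hF _ _ hu1 hu2.
rewrite fE /tri_adj => uv.
suff [/hE//|/hE] : later (g u) (g v) \/ later (g v) (g u).
  by rewrite compatible_sym neg_sym.
move: uv (fA u) (fA v); rewrite /later /g !inE !xpair_eqE /=.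
case: (f u) (f v) => [a b] [a' b'] /= uv hu hv.
by case/or4P: uv => [|||/or3P[]] /andP[/eqP h1 /eqP h2];
  [left; apply/or3P; constructor 1 | right; apply/or3P; constructor 1
  |right; apply/or3P; constructor 2| left; apply/or3P; constructor 2
  |left; apply/or3P; constructor 3 | right; apply/or3P; constructor 3]; lia.
Qed.
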